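(* Let $\gamma(z)=\sum_{j\in\mathbb{Z}}c_jz^j$ be a Laurent polynomial (only finitely many of the real constants $c_j$ are nonzero) with $\gamma(1)=\sum_{j\in\mathbb{Z}}c_j\neq0$. Let $g$ be the function satisfying $g=1+z\gamma(g)$, let $f=z\dfrac{\gamma(g)}{g\,\gamma(1/g)}$, and let the power series $\eta=\eta(z)$ and $H=H(z)$ be defined by $$\eta\left(\frac{(z-1)^2}{z}\right)=\gamma(z)\,\gamma\left(\frac1z\right),\qquad H\left(\frac{(z-1)^2}{z}\right)=\frac{\gamma(z)-z\gamma\left(\frac1z\right)}{z-1}$$ (so that $B_f=H\circ\overline{(z/\eta)}$). Then $$\eta(z)=\gamma(1)^2+z\sum_{n=1}^{\infty}\left(\sum_{j\in\mathbb{Z}}c_jc_{n+j}\right)p_{n-1}(z)$$ and $$H(z)=\sum_{n\in\mathbb{Z}}c_nP_{n-1}(z).$$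
   Context: Let $U_l$ be the Chebyshev polynomials of the second kind, $U_l(\cos\theta)=\frac{\sin((l+1)\theta)}{\sin\theta}$, with $U_{-1}=0$. For each integer $l\ge0$ define $$p_{2l}(z)=\left(U_l\left(\tfrac{z+2}{2}\right)+U_{l-1}\left(\tfrac{z+2}{2}\right)\right)^2,\qquad p_{2l+1}(z)=(z+4)\left(U_l\left(\tfrac{z+2}{2}\right)\right)^2.$$ For $n\ge0$ define $P_n(z)=U_n\left(\tfrac{z+2}{2}\right)+U_{n-1}\left(\tfrac{z+2}{2}\right)$, and extend to negative indices by $P_{-n}(z)=-P_{n-1}(z)$ for $n\ge1$. The B-function $B_f\in\mathbb{R}[[z]]$ of $f$ is defined by $f-z=zf\,B_f(zf)$; the overline denotes compositional inverse. $g$ is a formal power series with $g(0)=1$. *)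

(* Defs.v *)
From HB Require Import structures.
From mathcomp Require Import all_boot all_order all_algebra.
From mathcomp Require Import boolp classical_sets cardinality fsbigop reals.
From mathcomp Require Import topology normedtype sequences exp trigo.

Set Implicit Arguments.
Unset Strict Implicit.
Unset Printing Implicit Defensive.

Import Order.TTheory GRing.Theory Num.Theory.
Local Open Scope ring_scope.

(** * Formal power series over a field *)

Record fps (R : Type) := Fps { fpscoef : nat -> R }.

HB.instance Definition _ (R : Type) := gen_eqMixin (fps R).
HB.instance Definition _ (R : Type) := gen_choiceMixin (fps R).

Lemma fpsP (R : Type) (a b : fps R) : fpscoef a =1 fpscoef b -> a = b.
Proof. by case: a b => [a] [b] /= /funext ->. Qed.

Section FpsRing.
Variable R : fieldType.
Implicit Types a b c : fps R.

Definition fps_zero : fps R := Fps (fun=> 0).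
Definition fps_opp a : fps R := Fps (fun n => - fpscoef a n).
Definition fps_add a b : fps R := Fps (fun n => fpscoef a n + fpscoef b n).

Fact fps_addA : associative fps_add.
Proof. by move=> a b c; apply: fpsP => n /=; rewrite addrA. Qed.
Fact fps_addC : commutative fps_add.
Proof. by move=> a b; apply: fpsP => n /=; rewrite addrC. Qed.
Fact fps_add0 : left_id fps_zero fps_add.
Proof. by move=> a; apply: fpsP => n /=; rewrite add0r. Qed.
Fact fps_addN : left_inverse fps_zero fps_opp fps_add.
Proof. by move=> a; apply: fpsP => n /=; rewrite addNr. Qed.

HB.instance Definition _ :=
  GRing.isZmodule.Build (fps R) fps_addA fps_addC fps_add0 fps_addN.

Definition fps_of_poly (p : {poly R}) : fps R := Fps (fun n => p`_n).

Definition fps_one : fps R := fps_of_poly 1.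
Definition fps_mul a b : fps R :=
  Fps (fun n => \sum_(i < n.+1) fpscoef a i * fpscoef b (n - i)).

Let trunc n a : {poly R} := \poly_(i < n.+1) fpscoef a i.

Let coef_trunc n a i : (i <= n)%N -> (trunc n a)`_i = fpscoef a i.
Proof. by move=> le_in; rewrite coef_poly ltnS le_in. Qed.

Let coef_mul_trunc n a b i : (i <= n)%N ->
  fpscoef (fps_mul a b) i = (trunc n a * trunc n b)`_i.
Proof.
move=> le_in; rewrite coefM; apply: eq_bigr => j _.
rewrite !coef_trunc // ?(leq_trans _ le_in) ?leq_subr //; exact: leq_ord.
Qed.

Fact fps_mulC : commutative fps_mul.
Proof.
by move=> a b; apply: fpsP => n; rewrite !(@coef_mul_trunc n) // mulrC.
Qed.

Fact fps_mulA : associative fps_mul.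
Proof.
move=> a b c; apply: fpsP => n.
transitivity (trunc n a * (trunc n b * trunc n c))`_n.
  rewrite coefM; apply: eq_bigr => i _.
  by rewrite (coef_trunc a (leq_ord i)) (@coef_mul_trunc n) ?leq_subr.
rewrite mulrA coefM; apply: eq_bigr => i _.
by rewrite coef_trunc ?leq_subr // (coef_mul_trunc a b (leq_ord i)).
Qed.

Fact fps_mul1 : left_id fps_one fps_mul.
Proof.
move=> a; apply: fpsP => n /=; rewrite big_ord_recl /= coef1 mul1r subn0.
by rewrite big1 ?addr0 // => i _; rewrite coef1 mul0r.
Qed.

Fact fps_mulDl : left_distributive fps_mul +%R.
Proof.
move=> a b c; apply: fpsP => n /=; rewrite -big_split.
by apply: eq_bigr => i _; rewrite mulrDl.
Qed.

Fact fps_one_neq0 : fps_one != 0.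
Proof.
apply/eqP => /(congr1 (fun a => fpscoef a 0)) /=.
by rewrite coef1; apply/eqP/oner_neq0.
Qed.

HB.instance Definition _ := GRing.Zmodule_isComNzRing.Build (fps R)
  fps_mulA fps_mulC fps_mul1 fps_mulDl fps_one_neq0.

Definition fps_scale (k : R) a : fps R := Fps (fun n => k * fpscoef a n).

Fact fps_scaleA k l a : fps_scale k (fps_scale l a) = fps_scale (k * l) a.
Proof. by apply: fpsP => n /=; rewrite mulrA. Qed.
Fact fps_scale1 : left_id 1 fps_scale.
Proof. by move=> a; apply: fpsP => n /=; rewrite mul1r. Qed.
Fact fps_scaleDr : right_distributive fps_scale +%R.
Proof. by move=> k a b; apply: fpsP => n /=; rewrite mulrDr. Qed.
Fact fps_scaleDl a : {morph fps_scale^~ a : k l / k + l}.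
Proof. by move=> k l; apply: fpsP => n /=; rewrite mulrDl. Qed.

HB.instance Definition _ := GRing.Zmodule_isLmodule.Build R (fps R)
  fps_scaleA fps_scale1 fps_scaleDr fps_scaleDl.

Fact fps_scaleAl (k : R) a b : k *: (a * b) = (k *: a) * b.
Proof.
apply: fpsP => n /=; rewrite mulr_sumr.
by apply: eq_bigr => i _; rewrite mulrA.
Qed.

HB.instance Definition _ :=
  GRing.Lmodule_isLalgebra.Build R (fps R) fps_scaleAl.
HB.instance Definition _ := GRing.Lalgebra_isComAlgebra.Build R (fps R).

Lemma fpscoefM a b n :
  fpscoef (a * b) n = \sum_(i < n.+1) fpscoef a i * fpscoef b (n - i).
Proof. by []. Qed.

Lemma fpscoef1 n : fpscoef (1 : fps R) n = (n == 0%N)%:R.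
Proof. exact: coef1. Qed.

(* The list of the first n.+1 coefficients of the inverse of a, obtained by
   solving b * a = 1 degree by degree. *)
Fixpoint fps_inv_seq a n : seq R :=
  if n is m.+1 then
    let s := fps_inv_seq a m in
    rcons s (- (\sum_(i < n) s`_i * fpscoef a (n - i)) / fpscoef a 0)
  else [:: (fpscoef a 0)^-1].

Definition fps_unit : pred (fps R) := fun a => fpscoef a 0 != 0.
Definition fps_inv a : fps R :=
  if fps_unit a then Fps (fun n => (fps_inv_seq a n)`_n) else a.

Let size_inv_seq a n : size (fps_inv_seq a n) = n.+1.
Proof. by elim: n => //= n IHn; rewrite size_rcons IHn. Qed.

Let nth_inv_seq a n i : (i <= n)%N ->
  (fps_inv_seq a n)`_i = (fps_inv_seq a i)`_i.
Proof.
elim: n => [|n IHn]; first by rewrite leqn0 => /eqP->.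
rewrite leq_eqVlt => /predU1P[-> //|lt_in].
by rewrite [fps_inv_seq a n.+1]/= nth_rcons size_inv_seq lt_in IHn.
Qed.

Fact fps_mulVr : {in fps_unit, left_inverse 1 fps_inv *%R}.
Proof.
move=> a; rewrite -topredE /= => Ua; apply: fpsP => n.
rewrite /fps_inv Ua fpscoefM fpscoef1 big_ord_recr /= subnn.
case: n => [|n]; first by rewrite big_ord0 add0r mulVf.
rewrite /= nth_rcons size_inv_seq ltnn eqxx divfK //.
apply/eqP; rewrite subr_eq0; apply/eqP/eq_bigr => i _ /=.
by rewrite (nth_inv_seq a (leq_ord i)).
Qed.

Fact fps_unitPl a b : b * a = 1 -> fps_unit a.
Proof.
move=> /(congr1 (fun c => fpscoef c 0)).
rewrite fpscoefM fpscoef1 big_ord1 /fps_unit /= => ba1.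
by apply/eqP => a0; move/eqP: ba1; rewrite a0 mulr0 eq_sym oner_eq0.
Qed.

Fact fps_inv_out : {in [predC fps_unit], fps_inv =1 id}.
Proof. by move=> a /negbTE; rewrite /fps_inv -topredE /= => ->. Qed.

HB.instance Definition _ := GRing.ComNzRing_hasMulInverse.Build (fps R)
  fps_mulVr fps_unitPl fps_inv_out.

Lemma fps_unitE a : (a \is a GRing.unit) = (fpscoef a 0 != 0).
Proof. by []. Qed.

Definition fpsX : fps R := fps_of_poly 'X.

(* a(b(z)); only meaningful when b has zero constant term, in which case b ^+ k
   has no terms of degree below k and the sum can be cut at k = n. *)
Definition fps_comp a b : fps R :=
  Fps (fun n => \sum_(k < n.+1) fpscoef a k * fpscoef (b ^+ k) n).

Definition is_comp_inverse a b :=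
  [/\ fpscoef a 0 = 0, fpscoef b 0 = 0, fps_comp a b = fpsX
    & fps_comp b a = fpsX].

Definition fps_cinv a : fps R := xget 0 [set b | is_comp_inverse a b]%classic.

(* B is the B-function of f: f - z = z f B(z f). *)
Definition is_Bfunction (f B : fps R) :=
  f - fpsX = fpsX * f * fps_comp B (fpsX * f).

End FpsRing.

Arguments fpsX {R}.
Notation "a \oF b" := (fps_comp a b)
  (at level 50, left associativity) : ring_scope.

(** * Laurent polynomials *)

(* A Laurent polynomial is given by its coefficients c : int -> R, with finite
   support; laurent_eval c x is its value at an invertible element x. *)
Definition laurent_eval (R : fieldType) (A : unitAlgType R)
    (c : int -> R) (x : A) : A :=
  \sum_(j \in [set: int]) c j *: x ^ j.

(** * Chebyshev polynomials of the second kind *)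

Section Chebyshev.
Variable R : realType.

Definition chebyshevU_spec (l : nat) (p : {poly R}) :=
  forall theta : R, sin theta != 0 ->
    p.[cos theta] = sin (l.+1%:R * theta) / sin theta.

(* Indexed by int for the sake of U_(-1) = 0; smaller indices are not used. *)
Definition chebyshevU (l : int) : {poly R} :=
  match l with
  | Posz m => xget 0 [set p | chebyshevU_spec m p]%classic
  | Negz _ => 0
  end.

Lemma chebyshevU_exists (l : nat) : exists p, chebyshevU_spec l p.
Proof.
suff [p [q [Hp _]]] :
    exists p q, chebyshevU_spec l p /\ chebyshevU_spec l.+1 q by exists p.
elim: l => [|l [p [q [Hp Hq]]]].
  exists 1, ('X *+ 2); split=> theta s0; first by rewrite hornerC mul1r divff.
  rewrite hornerMn hornerX mulr_natl sin_mulr2n.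
  by rewrite -mulrnAl mulfK.
exists q, ('X *+ 2 * q - p); split=> // theta s0.
rewrite hornerD hornerN hornerM hornerMn hornerX Hp // Hq //.
rewrite mulrA -mulrBl; congr (_ / _).
set t := l.+2%:R * theta.
have -> : l.+1%:R * theta = t - theta.
  by rewrite /t -[l.+2]addn1 natrD mulrDl mul1r addrK.
have -> : l.+3%:R * theta = t + theta.
  by rewrite /t -[l.+3]addn1 natrD mulrDl mul1r.
rewrite sinB sinD opprB addrA mulrnAl mulr2n [cos theta * _]mulrC.
by rewrite addrAC addrK.
Qed.

Lemma chebyshevUP (l : nat) : chebyshevU_spec l (chebyshevU l).
Proof. exact: xgetPex (chebyshevU_exists l). Qed.

(* U_l ((z + 2) / 2) *)
Definition shiftedU (l : int) : {poly R} :=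
  chebyshevU l \Po (2^-1 *: ('X + 2%:P)).

Definition p_poly (n : nat) : {poly R} :=
  if odd n then ('X + 4%:P) * shiftedU n./2 ^+ 2
  else (shiftedU n./2 + shiftedU (n./2%:Z - 1)) ^+ 2.

Definition P_poly (n : int) : {poly R} :=
  match n with
  | Posz m => shiftedU m + shiftedU (m%:Z - 1)
  | Negz m => - (shiftedU m + shiftedU (m%:Z - 1)) (* P_(-(m+1)) = - P_m *)
  end.

End Chebyshev.

(* Main.v *)
(* The substitution z = (x - 1)^2 / x turns both P_n and p_n into Laurent
   polynomials in x: P_(n-1) becomes (x^n - x^(1-n)) / (x - 1) and z p_(n-1)
   becomes x^n + x^-n - 2. In R[[u]] with x = 1 + u, the series (x - 1)^2 / x is
   u^2 times a unit, so composition with it is injective and the formulas for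
   eta and H follow by comparing Laurent polynomials in x.
   For B_f put W = (g - 1)^2 / g. Since g - 1 = z gamma(g), the definitions give
   z f = (z / eta)(W) and f - z = z f H(W), so W is the compositional inverse
   of z / eta evaluated at z f, and z f can be cancelled from the composition. *)
Require Import Defs.
From mathcomp Require Import all_boot all_order all_algebra.
From mathcomp Require Import boolp classical_sets cardinality fsbigop reals.
From mathcomp Require Import trigo zify ring.

Set Implicit Arguments.
Unset Strict Implicit.
Unset Printing Implicit Defensive.

Import Order.TTheory GRing.Theory Num.Theory.
Local Open Scope ring_scope.

(** * Composition of formal power series and compositional inverses *)

Section FpsComp.
Variable R : fieldType.
Implicit Types (a b d : fps R) (p q : {poly R}).

Lemma fpscoefD a b n : fpscoef (a + b) n = fpscoef a n + fpscoef b n.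
Proof. by []. Qed.

Lemma fpscoefZ (k : R) a n : fpscoef (k *: a) n = k * fpscoef a n.
Proof. by []. Qed.

Lemma fpscoef_comp a b n :
  fpscoef (a \oF b) n = \sum_(k < n.+1) fpscoef a k * fpscoef (b ^+ k) n.
Proof. by []. Qed.

Lemma fpscoef_sum I (r : seq I) (F : I -> fps R) n :
  fpscoef (\sum_(i <- r) F i) n = \sum_(i <- r) fpscoef (F i) n.
Proof. exact: (big_morph (fun a => fpscoef a n)). Qed.

Lemma fps_of_polyM p q : fps_of_poly (p * q) = fps_of_poly p * fps_of_poly q.
Proof. by apply: fpsP => n; rewrite /= coefM. Qed.

Lemma fps_of_polyXn n : fps_of_poly 'X^n = fpsX ^+ n :> fps R.
Proof. by elim: n => // n IHn; rewrite !exprS fps_of_polyM IHn. Qed.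

Lemma fpscoefM0 a b : fpscoef (a * b) 0 = fpscoef a 0 * fpscoef b 0.
Proof. by rewrite fpscoefM big_ord1. Qed.

Lemma fpscoefV0 a : a \is a GRing.unit -> fpscoef a^-1 0 = (fpscoef a 0)^-1.
Proof.
move=> Ua; have /(congr1 (fun d => fpscoef d 0)) := mulVr Ua.
by rewrite fpscoefM0 fpscoef1 => /mulr1_eq<-; rewrite invrK.
Qed.

Lemma fpscoefXz0 a (j : int) : fpscoef a 0 = 1 -> fpscoef (a ^ j) 0 = 1.
Proof.
move=> a0; have aX0 n : fpscoef (a ^+ n) 0 = 1.
  by elim: n => [|n IHn]; rewrite ?fpscoef1 // exprS fpscoefM0 a0 IHn mulr1.
by case: j => n; rewrite /exprz ?fpscoefV0 ?fps_unitE ?aX0 ?invr1 ?oner_neq0.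
Qed.

Lemma fpscoefX0 : fpscoef (fpsX : fps R) 0 = 0.
Proof. exact: coefX. Qed.

Lemma fpscoefXM0 a : fpscoef (fpsX * a) 0 = 0.
Proof. by rewrite fpscoefM0 fpscoefX0 mul0r. Qed.

Lemma fpscoefXM a n : fpscoef (fpsX * a) n.+1 = fpscoef a n.
Proof.
rewrite fpscoefM 2!big_ord_recl /= !coefX mul0r add0r mul1r subSS subn0.
by rewrite big1 ?addr0 // => i _; rewrite coefX mul0r.
Qed.

Lemma fpsXM_surj a : fpscoef a 0 = 0 -> exists b, a = fpsX * b.
Proof.
move=> a0; exists (Fps (fun n => fpscoef a n.+1)); apply: fpsP => -[|n].
  by rewrite fpscoefXM0.
by rewrite fpscoefXM.
Qed.

(** The series cancelled later are products of [fpsX] and units, so their regularity is all that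
    cancellation requires. *)
Lemma lreg_fpsX : GRing.lreg (fpsX : fps R).
Proof.
move=> a b eq_ab; apply: fpsP => n.
by rewrite -(fpscoefXM a) eq_ab fpscoefXM.
Qed.

Lemma lreg_unit a : a \is a GRing.unit -> GRing.lreg a.
Proof. exact: mulrI. Qed.

Lemma fpscoefX_low b k m : fpscoef b 0 = 0 -> (m < k)%N -> fpscoef (b ^+ k) m = 0.
Proof.
move=> /fpsXM_surj[{}b ->]; rewrite exprMn.
elim: k m => // k IHk [|m]; rewrite exprS -mulrA ?fpscoefXM0 // ltnS => lt_mk.
by rewrite fpscoefXM exprS mulrCA mulrC fpscoefM big1 // => i _;
  rewrite IHk ?mul0r // (leq_trans _ lt_mk) // ltnS leq_ord.
Qed.

(** Congruence modulo [fpsX ^+ n.+1]. It reduces identities about composition to polynomials, where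
    composing is evaluating. *)
Definition fps_congr n a b := forall m, (m <= n)%N -> fpscoef a m = fpscoef b m.

Lemma fps_congrP a b : (forall n, fps_congr n a b) -> a = b.
Proof. by move=> eq_ab; apply: fpsP => n; apply: eq_ab (leqnn n). Qed.

Lemma fps_congrM n a a' b b' :
  fps_congr n a a' -> fps_congr n b b' -> fps_congr n (a * b) (a' * b').
Proof.
move=> eqa eqb m le_mn; rewrite !fpscoefM; apply: eq_bigr => i _.
by rewrite eqa ?eqb ?(leq_trans _ le_mn) ?leq_subr ?leq_ord.
Qed.

Definition fps_trunc n a : {poly R} := \poly_(i < n.+1) fpscoef a i.

Lemma fps_trunc_congr n a : fps_congr n a (fps_of_poly (fps_trunc n a)).
Proof. by move=> m le_mn; rewrite /= coef_poly ltnS le_mn. Qed.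

Lemma fps_comp_congr n a a' b : fps_congr n a a' -> fps_congr n (a \oF b) (a' \oF b).
Proof.
move=> eqa m le_mn; apply: eq_bigr => k _.
by rewrite eqa // (leq_trans _ le_mn) // leq_ord.
Qed.

Lemma fps_compD a a' b : (a + a') \oF b = (a \oF b) + (a' \oF b).
Proof.
apply: fpsP => n; rewrite fpscoefD !fpscoef_comp -big_split.
by apply: eq_bigr => k _; rewrite fpscoefD mulrDl.
Qed.

Lemma fps_compZ (k : R) a b : (k *: a) \oF b = k *: (a \oF b).
Proof.
apply: fpsP => n; rewrite fpscoefZ !fpscoef_comp mulr_sumr.
by apply: eq_bigr => i _; rewrite fpscoefZ mulrA.
Qed.

Lemma fps_comp_sum I (r : seq I) (F : I -> fps R) b :
  (\sum_(i <- r) F i) \oF b = \sum_(i <- r) (F i \oF b).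
Proof.
apply: (big_morph (fun a => a \oF b)) => [a a'|]; first exact: fps_compD.
by rewrite -(scale0r (0 : fps R)) fps_compZ !scale0r.
Qed.

Lemma fps_compB a a' b : (a - a') \oF b = (a \oF b) - (a' \oF b).
Proof. by rewrite fps_compD -[- a']scaleN1r fps_compZ scaleN1r. Qed.

Lemma horner_algE (A : comAlgType R) (x : A) p :
  horner_alg x p = \sum_(i < size p) p`_i *: x ^+ i.
Proof.
rewrite -[p in LHS]coefK poly_def linear_sum; apply: eq_bigr => i _.
by rewrite linearZ rmorphXn /= horner_algX mulr_algl.
Qed.

Section Substitution.
Variable b : fps R.
Hypothesis b0 : fpscoef b 0 = 0.

(** Both sums extend to a common length: terms beyond [size p] vanish with the coefficients of [p],
    and terms beyond [n] vanish because [b ^+ k] starts in degree [k]. *)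
Lemma fps_comp_poly p : fps_of_poly p \oF b = horner_alg b p.
Proof.
apply: fpsP => n; rewrite horner_algE fpscoef_sum /=.
pose F k := p`_k * fpscoef (b ^+ k) n.
have extend m N : (m <= N)%N -> (forall k, (m <= k)%N -> F k = 0) ->
    \sum_(k < m) F k = \sum_(k < N) F k.
  move=> le_mN F0; rewrite (big_ord_widen _ _ le_mN) big_mkcond.
  by apply: eq_bigr => k _; case: ltnP => // /F0.
rewrite (extend _ (maxn n.+1 (size p))) ?leq_maxl //; last first.
  by move=> k lt_nk; rewrite /F fpscoefX_low ?mulr0.
rewrite -(extend (size p)) ?leq_maxr // => k lt_pk.
by rewrite /F nth_default ?mul0r.
Qed.

Lemma fps_compX : fpsX \oF b = b.
Proof. by rewrite fps_comp_poly horner_algX. Qed.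

Lemma fps_comp1 : 1 \oF b = 1.
Proof. by rewrite [1 in LHS]/(fps_of_poly 1) fps_comp_poly rmorph1. Qed.

(** Up to degree [n] both factors may be replaced by their truncations, and evaluation of
    polynomials is a ring morphism. *)
Lemma fps_compM a a' : (a * a') \oF b = (a \oF b) * (a' \oF b).
Proof.
apply: fps_congrP => n m le_mn.
have ta := fps_trunc_congr (n := n) a; have ta' := fps_trunc_congr (n := n) a'.
rewrite (fps_comp_congr b (fps_congrM ta ta') le_mn).
rewrite (fps_congrM (fps_comp_congr b ta) (fps_comp_congr b ta') le_mn).
by rewrite -fps_of_polyM !fps_comp_poly rmorphM.
Qed.

Lemma fps_compXn a n : (a ^+ n) \oF b = (a \oF b) ^+ n.
Proof. by elim: n => [|n IHn]; rewrite ?fps_comp1 // !exprS fps_compM IHn. Qed.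

Lemma fpscoef_comp0 a : fpscoef (a \oF b) 0 = fpscoef a 0.
Proof. by rewrite /= big_ord1 expr0 fpscoef1 mulr1. Qed.

Lemma fps_comp_unit a : (a \oF b \is a GRing.unit) = (a \is a GRing.unit).
Proof. by rewrite !fps_unitE fpscoef_comp0. Qed.

Lemma fps_compV a : a \is a GRing.unit -> a^-1 \oF b = (a \oF b)^-1.
Proof.
move=> Ua; apply: (@mulrI _ (a \oF b)); first by rewrite fps_comp_unit.
by rewrite -fps_compM !divrr ?fps_comp1 ?fps_comp_unit.
Qed.

Lemma fps_compXz a (j : int) : a \is a GRing.unit -> (a ^ j) \oF b = (a \oF b) ^ j.
Proof.
by move=> Ua; case: j => n; rewrite /exprz ?fps_compV ?unitrX // fps_compXn.
Qed.

End Substitution.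

Lemma fps_compA a b d : fpscoef b 0 = 0 -> fpscoef d 0 = 0 ->
  a \oF b \oF d = a \oF (b \oF d).
Proof.
move=> b0 d0; apply: fps_congrP => n m le_mn.
have ta := fps_trunc_congr (n := n) a.
rewrite (fps_comp_congr d (fps_comp_congr b ta) le_mn).
rewrite (fps_comp_congr _ ta le_mn) !fps_comp_poly ?fpscoef_comp0 //.
rewrite !horner_algE fps_comp_sum; congr (fpscoef _ m); apply: eq_bigr => i _.
by rewrite fps_compZ fps_compXn.
Qed.

Lemma fps_compr0 a : a \oF fpsX = a.
Proof.
apply: fps_congrP => n m le_mn; have ta := fps_trunc_congr (n := n) a.
rewrite (fps_comp_congr _ ta le_mn) fps_comp_poly ?fpscoefX0 // ta //.
rewrite horner_algE fpscoef_sum /= -[in RHS](coefK (fps_trunc n a)) poly_def.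
by rewrite coef_sum; apply: eq_bigr => i _; rewrite -fps_of_polyXn coefZ.
Qed.

(** If [a \oF b = 0], then [a] has zero constant term, so [a = fpsX * a'] and [b * (a' \oF b) = 0].
    Cancelling [b] leaves the same equation for [a'], whose coefficients are those of [a] shifted by
    one. *)
Lemma fps_comp_inj b : fpscoef b 0 = 0 -> GRing.lreg b ->
  injective (fun a => a \oF b).
Proof.
move=> b0 rb a a' /eqP; rewrite -subr_eq0 -fps_compB => /eqP ab0.
apply/eqP; rewrite -subr_eq0; apply/eqP/fpsP => n.
move: (a - a') ab0 => {a a'}; elim: n => [|n IHn] a ab0.
  by rewrite -(fpscoef_comp0 b) ab0.
have /fpsXM_surj[a' Da] : fpscoef a 0 = 0 by rewrite -(fpscoef_comp0 b) ab0.
rewrite Da fpscoefXM IHn //; apply: rb.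
by rewrite mulr0 -ab0 Da fps_compM // fps_compX.
Qed.

Lemma course_of_values (T : Type) (F : seq T -> T) :
  exists s : nat -> T, forall n, s n = F (mkseq s n).
Proof.
pose L n := iter n (fun s => rcons s (F s)) [::].
exists (F \o L) => n /=; congr F.
by elim: n => //= n IHn; rewrite mkseqS -IHn.
Qed.

(* Comparing coefficients of degree n, the terms involving b_n, b_(n+1), ...
   reduce to b_n a_1^n, so b is determined recursively. *)
Lemma fps_comp_linv a : fpscoef a 0 = 0 -> fpscoef a 1 != 0 ->
  exists b, b \oF a = fpsX.
Proof.
move=> a0 a1.
have [b bE] := course_of_values (fun s : seq R => let n := size s in
  ((n == 1)%N%:R - \sum_(k < n) s`_k * fpscoef (a ^+ k) n) / fpscoef (a ^+ n) n).
exists (Fps b); apply: fpsP => n; rewrite /= big_ord_recr /= coefX.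
rewrite [b n in X in _ + X]bE size_mkseq divfK; last first.
  (* The divisor is nonzero: with [a = fpsX * a'], the coefficient of degree [n] in [a ^+ n] is the
     constant term of [a' ^+ n]. *)
  have [a' Da] := fpsXM_surj a0; rewrite Da exprMn.
  have {a1} : fpscoef a' 0 != 0 by rewrite -(fpscoefXM a') -Da.
  elim: n => [|n IHn] a'0; first by rewrite mul1r fpscoef1 oner_eq0.
  rewrite exprS -mulrA fpscoefXM exprS mulrCA fpscoefM big_ord_recl subn0.
  rewrite big1 ?addr0 ?mulf_neq0 ?IHn // => i _.
  rewrite -exprMn fpscoefX_low ?mulr0 ?fpscoefXM0 //=.
  by rewrite subnSK // leq_subr.
apply/eqP; rewrite addrCA -subr_eq0 addrAC subrr add0r subr_eq0; apply/eqP.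
by apply: eq_bigr => k _; rewrite nth_mkseq.
Qed.

(** A left inverse [b] of [a] has [b_1 a_1 = 1], hence a left inverse [d] of its own. Associativity
    gives [d = d \oF (b \oF a) = a], so [b] is two-sided. *)
Lemma fps_cinvP a : fpscoef a 0 = 0 -> fpscoef a 1 != 0 ->
  is_comp_inverse a (fps_cinv a).
Proof.
move=> a0 a1; apply: xgetPex.
have [b ba] := fps_comp_linv a0 a1.
have b0 : fpscoef b 0 = 0 by rewrite -(fpscoef_comp0 a) ba fpscoefX0.
have b1 : fpscoef b 1 != 0.
  have := congr1 (fun d => fpscoef d 1) ba.
  rewrite /= big_ord_recl big_ord1 /= b0 mul0r add0r expr1 coefX => ba1.
  by apply: contraTneq (oner_neq0 R) => b10; rewrite -[1]ba1 b10 mul0r eqxx.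
have [d db] := fps_comp_linv b0 b1.
have Dd : d = a by rewrite -[d]fps_compr0 -ba -fps_compA // db fps_compX.
by exists b; split; rewrite // -[in LHS]Dd.
Qed.

End FpsComp.

(** * Chebyshev recurrences and evaluation at [(z - 1)^2 / z] *)

Section Chebyshev.
Variable R : realType.
Implicit Types p q : {poly R}.

Lemma poly_eq_on_interval p q :
  (forall x, -1 < x < 1 -> p.[x] = q.[x]) -> p = q.
Proof.
move=> eq_pq; apply/eqP; rewrite -subr_eq0; apply: contraT => nz_pq.
(* The points [1 / (k + 2)] lie in [(0, 1)] and are distinct; there are [size (p - q)] of them, one
   more than the degree allows as roots. *)
pose rs : seq R := [seq k.+2%:R^-1 | k <- iota 0 (size (p - q))].
suff /(max_poly_roots nz_pq) : all (root (p - q)) rs.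
  rewrite size_map size_iota ltnn => -> //.
  by rewrite map_inj_uniq ?iota_uniq // => i j /invr_inj/eqP;
    rewrite eqr_nat => /eqP[].
apply/allP => _ /mapP[k _ ->]; rewrite /root hornerD hornerN subr_eq0.
have k_gt0 : (0 : R) < k.+2%:R by rewrite ltr0n.
rewrite eq_pq // (lt_trans (ltrN10 R)) ?invr_gt0 //=.
by rewrite invf_lt1 // ltr1n.
Qed.

(** The specification fixes the values at all [cos theta] with [sin theta != 0], which fill the open
    interval [(-1, 1)]. Identities for the chosen polynomial [chebyshevU] thus reduce to
    trigonometry. *)
Lemma chebyshevU_spec_uniq l p q :
  chebyshevU_spec l p -> chebyshevU_spec l q -> p = q.
Proof.
move=> Hp Hq; apply: poly_eq_on_interval => x /andP[lt_N1x lt_x1].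
have x_le : -1 <= x <= 1 by rewrite !ltW.
have sin0 : sin (acos x) != 0.
  rewrite sin_acos // sqrtr_eq0 -ltNge subr_gt0 -real_normK ?num_real //.
  by rewrite expr_lt1 ?normr_ge0 // ltr_norml lt_N1x.
by rewrite -(acosK (x := x)) ?Hp ?Hq // in_itv.
Qed.

Lemma chebyshevU0 : chebyshevU R 0 = 1.
Proof.
apply: (chebyshevU_spec_uniq (@chebyshevUP R 0)) => theta sin0.
by rewrite hornerC mul1r divff.
Qed.

Lemma chebyshevU_pred (l : nat) (theta : R) : sin theta != 0 ->
  (chebyshevU R (l%:Z - 1)).[cos theta] = sin (l%:R * theta) / sin theta.
Proof.
case: l => [|l] s0; first by rewrite sub0r horner0 mul0r sin0 mul0r.
by rewrite intS addrC addKr; exact: chebyshevUP.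
Qed.

Lemma chebyshevU_rec (l : nat) :
  chebyshevU R l.+1 = 'X *+ 2 * chebyshevU R l - chebyshevU R (l%:Z - 1).
Proof.
apply: (chebyshevU_spec_uniq (@chebyshevUP R l.+1)) => theta sin0.
rewrite hornerD hornerN hornerM hornerMn hornerX chebyshevU_pred //.
rewrite (chebyshevUP l) // mulrA -mulrBl; congr (_ / _).
rewrite (_ : l%:R * theta = l.+1%:R * theta - theta); last by rewrite -natr1; ring.
rewrite (_ : l.+2%:R * theta = l.+1%:R * theta + theta); last by rewrite -[in LHS]natr1; ring.
rewrite sinB sinD; ring.
Qed.

Lemma shiftedU0 : shiftedU R 0 = 1.
Proof. by rewrite /shiftedU chebyshevU0 comp_polyC. Qed.

Lemma shiftedUN1 : shiftedU R (-1) = 0.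
Proof. by rewrite /shiftedU comp_poly0. Qed.

Lemma shiftedU_rec (l : nat) :
  shiftedU R l.+1 = ('X + 2%:P) * shiftedU R l - shiftedU R (l%:Z - 1).
Proof.
rewrite /shiftedU chebyshevU_rec comp_polyB comp_polyM; congr (_ * _ - _).
rewrite (_ : 'X *+ 2 = 'X + 'X) // comp_polyD comp_polyX -scalerDl.
by rewrite (_ : 2^-1 + 2^-1 = 1 :> R) ?scale1r //; field.
Qed.

Section Evaluation.
(* [s] is [z^-1], so that [w + 2 = z + z^-1]. *)
Variables (A : comAlgType R) (z s : A).
Hypothesis zs : z * s = 1.
Let w := (z - 1) ^+ 2 * s.
Let U (l : int) := horner_alg w (shiftedU R l).

Let U_rec (l : nat) : U l.+1 = (z + s) * U l - U (l%:Z - 1).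
Proof.
rewrite /U shiftedU_rec rmorphB rmorphM rmorphD /= horner_algX horner_algC.
rewrite (_ : w + _ = z + s) // /w scaler_nat.
by rewrite sqrrB1 !mulrDl mul1r mulNr expr2 -mulrA zs mulr1 mulrnAl zs addrAC addrNK.
Qed.

(** With its mirror image under [z <-> s], this is a division-free form of
    [U_l = (z^(l+1) - s^(l+1)) / (z - s)]. The element [z - s] need not be invertible in [A], and it
    is not for [z = 1 + fpsX]. *)
Lemma shiftedU_evalZ (l : nat) : U l - z * U (l%:Z - 1) = s ^+ l.
Proof.
elim: l => [|l IHl].
  by rewrite sub0r /U shiftedU0 shiftedUN1 rmorph0 mulr0 subr0 rmorph1.
rewrite exprS -IHl U_rec intS [1 + _]addrC addrK.
ring: zs.
Qed.

Lemma shiftedU_evalV (l : nat) : U l - s * U (l%:Z - 1) = z ^+ l.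
Proof.
elim: l => [|l IHl].
  by rewrite sub0r /U shiftedU0 shiftedUN1 rmorph0 mulr0 subr0 rmorph1.
rewrite exprS -IHl U_rec intS [1 + _]addrC addrK.
ring: zs.
Qed.

(** The right side is [z (U_n - s U_(n-1)) - (U_n - z U_(n-1))], which equals
    [(z - 1) (U_n + U_(n-1))] because [z s = 1]. *)
Lemma P_poly_eval (n : nat) : horner_alg w (P_poly R n) * (z - 1) = z ^+ n.+1 - s ^+ n.
Proof.
rewrite exprS -shiftedU_evalZ -shiftedU_evalV /P_poly rmorphD /= -/(U _) -/(U _).
ring: zs.
Qed.

Lemma shiftedU_eval (l : nat) : U l * (z - s) = z ^+ l.+1 - s ^+ l.+1.
Proof.
rewrite !exprS -shiftedU_evalZ -shiftedU_evalV.
ring: zs.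
Qed.

(** Both parities give a square. For [n = 2l+1], [w (w + 4) = (z - s)^2] yields
    [(z^(l+1) - s^(l+1))^2]; for [n = 2l], [p_n = P_l^2] yields [s (z^(l+1) - s^l)^2]. *)
Lemma p_poly_eval (n : nat) :
  w * horner_alg w (p_poly R n) = z ^+ n.+1 + s ^+ n.+1 - 2.
Proof.
have zsX m : z ^+ m * s ^+ m = 1 by rewrite -exprMn zs expr1n.
rewrite -[in RHS](odd_double_half n) /p_poly; case: (odd n); move: n./2 => {n} l.
  rewrite add1n -doubleS -mul2n mulnC !exprM rmorphM rmorphXn rmorphD /=.
  rewrite horner_algX horner_algC scaler_nat -/(U _).
  transitivity ((U l * (z - s)) ^+ 2); last by rewrite shiftedU_eval; ring: (zsX l.+1).
  rewrite /w; ring: zs.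
rewrite rmorphXn -/(P_poly R l) add0n -mul2n mulnC.
transitivity (s * (horner_alg w (P_poly R l) * (z - 1)) ^+ 2).
  rewrite /w; ring.
rewrite P_poly_eval !(exprS _ (l * 2)) !exprM !(exprS _ l); ring: zs (zsX l).
Qed.

End Evaluation.
End Chebyshev.

(** * Sums over a finite support and autocorrelation *)

Section FiniteSupport.
Variables (R : fieldType) (c : int -> R) (S : seq int).
Hypotheses (uniqS : uniq S) (suppS : forall j, j \notin S -> c j = 0).

Lemma fsum_int_seq (V : zmodType) (F : int -> V) :
  (forall j, c j = 0 -> F j = 0) -> \sum_(j \in [set: int]) F j = \sum_(j <- S) F j.
Proof.
move=> F0; rewrite (fsbigE S) //; last by move=> j _ /suppS/F0.
by apply: eq_bigl => j; rewrite in_setT.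
Qed.

Lemma laurent_eval_seq (A : unitAlgType R) (x : A) :
  laurent_eval c x = \sum_(j <- S) c j *: x ^ j.
Proof. by apply: fsum_int_seq => j ->; rewrite scale0r. Qed.

(** The index [i] will be a shift [n + j] that may leave [S]; then both sides are zero since
    [c i = 0]. *)
Lemma sum_shift_eq (V : lmodType R) (i : int) (v : V) :
  \sum_(k <- S) (if k == i then c k *: v else 0) = c i *: v.
Proof.
have [Si|Si] := boolP (i \in S).
  by rewrite (bigD1_seq i) //= eqxx big1 ?addr0 // => k /negPf->.
rewrite big1_seq ?suppS ?scale0r // => k /andP[_ Sk].
by case: eqP => // ki; rewrite -ki Sk in Si.
Qed.

(* The double sum is grouped according to the difference n = k - j; the
   differences n and - n have the same coefficient. *)
Lemma autocorrelation_sum (V : lmodType R) (phi : int -> V) (N : nat) :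
    phi 0 = 0 -> (forall j k, j \in S -> k \in S -> (absz (k - j) < N)%N) ->
  \sum_(j <- S) \sum_(k <- S) (c j * c k) *: phi (k - j) =
  \sum_(1 <= n < N) (\sum_(j <- S) c j * c (n%:Z + j)) *: (phi n + phi (- n%:Z)).
Proof.
move=> phi0 ltN.
(* A pair [(j, k)] contributes only at [n = |k - j|], through the first branch if [k > j] and the
   second if [k < j]. Diagonal pairs drop out because [phi 0 = 0]. *)
pose G j k n := (if k == n%:Z + j then (c j * c k) *: phi n else 0)
              + (if j == n%:Z + k then (c j * c k) *: phi (- n%:Z) else 0).
transitivity (\sum_(j <- S) \sum_(k <- S) \sum_(1 <= n < N) G j k n).
  apply: eq_big_seq => j Sj; apply: eq_big_seq => k Sk.
  have [d Dk] : exists d, k = d + j by exists (k - j); rewrite addrNK.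
  move: (ltN _ _ Sj Sk); rewrite Dk addrK => ltdN {k Dk Sk}.
  have sum1 (m : nat) (v : V) : (0 < m < N)%N ->
      v = \sum_(1 <= n < N) (if n == m then v else 0).
    by move=> ltmN; rewrite -big_mkcond big_nat1_eq ltmN.
  case: d ltdN => [[|m]|m] ltmN; rewrite /G.
  - rewrite phi0 scaler0 big_nat big1 // => -[|n] // _.
    by rewrite !ifN ?addr0 //; lia.
  - rewrite [LHS](sum1 m.+1) //; apply: eq_big_nat => -[|n] // _.
    rewrite [if j == _ then _ else _]ifN ?addr0; last by lia.
    rewrite (_ : (_ + j == _ + j) = (n.+1 == m.+1)); last by lia.
    by case: eqP => // ->.
  - rewrite [LHS](sum1 m.+1) //; apply: eq_big_nat => -[|n] // _.
    rewrite [if _ + j == _ then _ else _]ifN ?add0r; last by lia.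
    rewrite (_ : (j == _) = (n.+1 == m.+1)); last by lia.
    by case: eqP => // ->.
under eq_bigr do rewrite exchange_big /=.
rewrite exchange_big /=; apply: eq_bigr => n _.
under eq_bigr do rewrite big_split /=.
rewrite big_split /= scalerDr; congr (_ + _); rewrite scaler_suml.
  apply: eq_bigr => j _; rewrite -scalerA -[c (_ + _) *: _]sum_shift_eq scaler_sumr.
  by apply: eq_bigr => k _; case: ifP; rewrite ?scaler0 ?scalerA.
rewrite exchange_big /=.
apply: eq_bigr => k _; rewrite -scalerA -[c (_ + _) *: _]sum_shift_eq scaler_sumr.
by apply: eq_bigr => j _; case: ifP; rewrite ?scaler0 // scalerA mulrC.
Qed.

End FiniteSupport.

Lemma finite_support_seq (R : fieldType) (c : int -> R) :
  finite_set [set j | c j != 0]%classic ->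
  exists S : seq int, uniq S /\ forall j, j \notin S -> c j = 0.
Proof.
move=> /finite_seqP[S cS]; exists (undup S); split; first exact: undup_uniq.
move=> j; rewrite mem_undup => /negP Sj; apply/eqP; apply: contra_notT Sj => cj.
by have : [set j | c j != 0]%classic j by []; rewrite cS.
Qed.

(** Bounds the [n] for which some [c_j c_(n+j)] can be nonzero, so that the sum over [n >= 1] can be
    cut off. *)
Lemma seq_int_diff_bound (S : seq int) :
  exists N, forall j k, j \in S -> k \in S -> (absz (k - j) < N)%N.
Proof.
exists (\max_(j <- S) \max_(k <- S) absz (k - j)).+1 => j k Sj Sk.
rewrite ltnS; apply: leq_trans (leq_bigmax_seq _ Sj _) => //.
exact: (leq_bigmax_seq (F := fun k => absz (k - j)) k Sk).
Qed.

(** * The formulas for [eta] and [H] as Laurent identities in [z] *)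

Section LaurentIdentities.
Variables (R : realType) (c : int -> R).
Hypothesis c_fin : finite_set [set j | c j != 0]%classic.
Variables (A : comUnitAlgType R) (z : A).
Hypothesis Uz : z \is a GRing.unit.
Let w := (z - 1) ^+ 2 / z.

(** The extension [P_(-n) = - P_(n-1)] is what keeps the formula valid for [n <= 0]: [z^n - z^(1-n)]
    changes sign under [n -> 1 - n]. *)
Lemma P_poly_eval_int (n : int) :
  horner_alg w (P_poly R (n - 1)) * (z - 1) = z ^ n - z * z^-1 ^ n.
Proof.
case: n => [[|n]|n].
- by rewrite sub0r /= rmorphN mulNr P_poly_eval ?divrr // mulr1 opprB.
- rewrite (_ : n.+1%:Z - 1 = n); last by lia.
  by rewrite P_poly_eval ?divrr // /exprz [z^-1 ^+ n.+1]exprS mulrA divrr // mul1r.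
- rewrite (_ : Negz n - 1 = Negz n.+1); last by lia.
  rewrite /P_poly -/(P_poly R n.+1) rmorphN mulNr P_poly_eval ?divrr // opprB.
  by rewrite /exprz -!exprVn invrK -exprS.
Qed.

Lemma H_poly_laurent :
  horner_alg w (\sum_(n \in [set: int]) c n *: P_poly R (n - 1)) * (z - 1) =
  laurent_eval c z - z * laurent_eval c z^-1.
Proof.
have [S [uniqS suppS]] := finite_support_seq c_fin.
rewrite (fsum_int_seq uniqS suppS) => [|j ->]; last by rewrite scale0r.
rewrite !(laurent_eval_seq uniqS suppS) linear_sum mulr_suml mulr_sumr -sumrB.
apply: eq_bigr => j _.
by rewrite linearZ /= mulr_algl -scalerAl P_poly_eval_int scalerBr scalerAr.
Qed.

(** The product is the double sum of [c_j c_k z^(k-j)]. Subtracting [gamma(1)^2] turns each power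
    into [z^(k-j) - 1], and pairing the differences [n] and [-n] gives [z^n + z^(-n) - 2], the value
    of [w p_(n-1)]. *)
Lemma eta_poly_laurent :
  horner_alg w
    (((\sum_(j \in [set: int]) c j) ^+ 2)%:P
     + 'X * \sum_(n \in [set n : nat | (1 <= n)%N]%classic)
         (\sum_(j \in [set: int]) c j * c (n%:Z + j)) *: p_poly R n.-1) =
  laurent_eval c z * laurent_eval c z^-1.
Proof.
have [S [uniqS suppS]] := finite_support_seq c_fin.
have [N ltN] := seq_int_diff_bound S.
have sumS := fsum_int_seq uniqS suppS.
have -> : \sum_(n \in [set n : nat | (1 <= n)%N]%classic)
    (\sum_(j \in [set: int]) c j * c (n%:Z + j)) *: p_poly R n.-1 =
  \sum_(1 <= n < N) (\sum_(j <- S) c j * c (n%:Z + j)) *: p_poly R n.-1.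
  transitivity (\sum_(n \in [set n : nat | (1 <= n)%N]%classic)
      (\sum_(j <- S) c j * c (n%:Z + j)) *: p_poly R n.-1).
    apply: eq_fsbigr => n _; congr (_ *: _).
    by apply: sumS => j ->; rewrite mul0r.
  rewrite [RHS]fsbig_seq ?iota_uniq //; apply/esym/fsbig_widen => n /=.
    by rewrite mem_index_iota => /andP[].
  (* For [n >= N] the indices [j] and [n + j] cannot both lie in [S], so the coefficient is zero. *)
  move=> [n_gt0]; rewrite mem_index_iota n_gt0 /= => /negP; rewrite -leqNgt => leNn.
  rewrite big_seq big1 ?scale0r // => j Sj.
  rewrite (suppS (n%:Z + j)) ?mulr0 //; apply: contraL leNn => Snj.
  by rewrite -ltnNge; have := ltN _ _ Sj Snj; rewrite addrK.
rewrite (sumS _ c) // !(laurent_eval_seq uniqS suppS).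
rewrite rmorphD /= horner_algC rmorphM /= horner_algX linear_sum mulr_sumr.
transitivity ((\sum_(j <- S) c j) ^+ 2 *: 1 +
    \sum_(j <- S) \sum_(k <- S) (c j * c k) *: (z ^ (k - j) - 1)).
  congr (_ + _).
  rewrite (autocorrelation_sum uniqS suppS (phi := fun n => z ^ n - 1) _ ltN);
    last by rewrite expr0z subrr.
  apply: eq_big_nat => -[|n] // _; rewrite linearZ /= mulr_algl -scalerAr.
  rewrite p_poly_eval ?divrr //; congr (_ *: _).
  by rewrite addrACA -opprD -exprz_inv.
rewrite expr2 mulr_suml scaler_suml -big_split mulrC mulr_suml.
apply: eq_bigr => j _; rewrite !mulr_sumr scaler_suml -big_split.
apply: eq_bigr => k _; rewrite /= -scalerDr addrC subrK.
by rewrite -scalerAl -scalerAr scalerA exprzDr // exprz_inv mulrC [z ^ k * _]mulrC.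
Qed.

End LaurentIdentities.

(** * Passage from [z = 1 + u] to [g], and the B-function *)

Lemma fps_comp_laurent (R : fieldType) (c : int -> R) (a b d : fps R) :
    finite_set [set j | c j != 0]%classic ->
    a \is a GRing.unit -> fpscoef b 0 = 0 -> a \oF b = d ->
  laurent_eval c a \oF b = laurent_eval c d.
Proof.
move=> /finite_support_seq[S [uniqS suppS]] Ua b0 <-.
rewrite !(laurent_eval_seq uniqS suppS) fps_comp_sum.
by apply: eq_bigr => j _; rewrite fps_compZ fps_compXz.
Qed.

Lemma fpscoef_laurent0 (R : fieldType) (c : int -> R) (a : fps R) :
    finite_set [set j | c j != 0]%classic -> fpscoef a 0 = 1 ->
  fpscoef (laurent_eval c a) 0 = \sum_(j \in [set: int]) c j.
Proof.
move=> /finite_support_seq[S [uniqS suppS]] a0.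
rewrite (laurent_eval_seq uniqS suppS) (fsum_int_seq uniqS suppS) // fpscoef_sum.
by apply: eq_bigr => j _; rewrite fpscoefZ fpscoefXz0 ?mulr1.
Qed.

(* With W = (g - 1)^2 / g one has (z / eta)(W) = z f and f - z = z f H(W). *)
Lemma is_Bfunction_comp (R : fieldType) (f g G G' eta H W : fps R) :
    G \is a GRing.unit -> G' \is a GRing.unit -> eta \is a GRing.unit ->
    g = 1 + fpsX * G -> f = fpsX * (G / (g * G')) -> W = (g - 1) ^+ 2 / g ->
    eta \oF W = G * G' -> (H \oF W) * (g - 1) = G - g * G' ->
  forall B, is_Bfunction f B <-> B = H \oF fps_cinv (fpsX / eta).
Proof.
move=> UG UG' Ueta gE fE WE etaW HW.
have uE : g - 1 = fpsX * G by rewrite gE addrC addKr.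
have Ug : g \is a GRing.unit.
  by rewrite fps_unitE gE fpscoefD fpscoef1 fpscoefXM0 addr0 oner_eq0.
have W0 : fpscoef W 0 = 0 by rewrite WE uE exprMn -!mulrA fpscoefXM0.
pose phi := fpsX / eta.
have [|_ psi0 _ psi_phi] := @fps_cinvP _ phi (fpscoefXM0 _).
  by rewrite /phi fpscoefXM fpscoefV0 // invr_eq0.
rewrite -/phi; set psi := fps_cinv phi in psi0 psi_phi *.
have XfE : phi \oF W = fpsX * f.
  rewrite /phi (fps_compM W0) (fps_compX W0) (fps_compV W0 Ueta) etaW WE fE uE.
  rewrite (invrM UG UG') (invrM Ug UG').
  have := divrr UG; move: G^-1 G'^-1 g^-1 => iG iG' ig GK.
  ring: GK.
have Xf0 := fpscoefXM0 f.
have reg_Xf : GRing.lreg (fpsX * f).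
  rewrite fE; do 2!apply: (lregM (@lreg_fpsX R)).
  by apply: lreg_unit; rewrite unitrM unitrV unitrM UG Ug.
have psiXf : psi \oF (fpsX * f) = W.
  by rewrite -XfE -(fps_compA _ (fpscoefXM0 _) W0) psi_phi (fps_compX W0).
have fB : f - fpsX = fpsX * f * (H \oF W).
  (* Since [g - 1 = fpsX * G], the series [fpsX * f] is [(g - 1) * fpsX / (g * G')]; its factor
     [g - 1] is the one needed to apply [HW]. *)
  transitivity (fpsX * (G'^-1 * g^-1) * ((H \oF W) * (g - 1))); last first.
    by rewrite uE fE (invrM Ug UG'); ring.
  rewrite HW fE (invrM Ug UG'); have := divrr UG'; have := divrr Ug.
  move: G'^-1 g^-1 => iG' ig gK GK'.
  ring: gK GK'.
move=> B; rewrite /is_Bfunction fB -[in X in X <-> _]psiXf -(fps_compA _ psi0 Xf0).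
by split=> [/reg_Xf/(fps_comp_inj Xf0 reg_Xf)|->].
Qed.
Theorem theorem5p1 (R : realType) (c : int -> R) (g f eta H : fps R)
    (c_fin : finite_set [set j | c j != 0]%classic)
    (c_sum : \sum_(j \in [set: int]) c j != 0)
    (g0 : fpscoef g 0 = 1)
    (gE : g = 1 + fpsX * laurent_eval c g)
    (fE : f = fpsX * (laurent_eval c g / (g * laurent_eval c g^-1)))
    (* the identities defining eta and H, in R[[u]] with z = 1 + u *)
    (etaE : let z : fps R := 1 + fpsX in
       eta \oF ((z - 1) ^+ 2 / z) = laurent_eval c z * laurent_eval c z^-1)
    (HE : let z : fps R := 1 + fpsX in
       (H \oF ((z - 1) ^+ 2 / z)) * (z - 1)
         = laurent_eval c z - z * laurent_eval c z^-1) :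
  [/\ forall B : fps R, is_Bfunction f B <-> B = H \oF fps_cinv (fpsX / eta),
      eta = fps_of_poly
        (((\sum_(j \in [set: int]) c j) ^+ 2)%:P
         + 'X * \sum_(n \in [set n : nat | (1 <= n)%N]%classic)
             (\sum_(j \in [set: int]) c j * c (n%:Z + j)) *: p_poly R n.-1)
    & H = fps_of_poly (\sum_(n \in [set: int]) c n *: P_poly R (n - 1))].
Proof.
move: etaE HE => /=; set z : fps R := 1 + fpsX; set w := (z - 1) ^+ 2 / z.
move=> etaE HE.
have z0 : fpscoef z 0 = 1 by rewrite fpscoefD fpscoef1 fpscoefX0 addr0.
have Uz : z \is a GRing.unit by rewrite fps_unitE z0 oner_neq0.
have zB1 : z - 1 = fpsX by rewrite /z addrC addKr.
have w0 : fpscoef w 0 = 0 by rewrite /w zB1 -mulrA fpscoefXM0.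
have reg_w : GRing.lreg w.
  rewrite /w zB1; apply: lregM; last by apply: lreg_unit; rewrite unitrV.
  exact/lregX/lreg_fpsX.
have comp_w := fps_comp_inj w0 reg_w.
split; last 2 first.
- by apply: comp_w; rewrite etaE fps_comp_poly // eta_poly_laurent.
- apply: comp_w; apply: lreg_fpsX; rewrite -zB1 ![(z - 1) * _]mulrC HE.
  by rewrite fps_comp_poly // H_poly_laurent.
have Ug : g \is a GRing.unit by rewrite fps_unitE g0 oner_neq0.
have UzV : z^-1 \is a GRing.unit by rewrite unitrV.
have u0 : fpscoef (g - 1) 0 = 0 by rewrite {1}gE addrC addKr fpscoefXM0.
(* Substituting [u = g - 1] turns [z = 1 + u] into [g], which carries the identities defining [eta]
   and [H] over to [g]. *)
have zu : z \oF (g - 1) = g.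
  by rewrite fps_compD fps_comp1 // fps_compX // addrC subrK.
have zVu : z^-1 \oF (g - 1) = g^-1 by rewrite (fps_compV u0 Uz) zu.
have gV0 : fpscoef g^-1 0 = 1 by rewrite fpscoefV0 // g0 invr1.
have zV0 : fpscoef z^-1 0 = 1 by rewrite fpscoefV0 // z0 invr1.
have Lz := fps_comp_laurent c_fin Uz u0 zu.
have LzV := fps_comp_laurent c_fin UzV u0 zVu.
apply: (is_Bfunction_comp (W := w \oF (g - 1)) _ _ _ gE fE).
(* The three unit conditions all come from [gamma(1) != 0]: the constant terms are [gamma(1)],
   [gamma(1)] and, by [etaE], [gamma(1)^2]. *)
- by rewrite fps_unitE (fpscoef_laurent0 c_fin g0).
- by rewrite fps_unitE (fpscoef_laurent0 c_fin gV0).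
- rewrite fps_unitE -(fpscoef_comp0 w) etaE fpscoefM0.
  by apply: mulf_neq0; rewrite fpscoef_laurent0.
- rewrite (fps_compM u0) (fps_compXn u0) zB1 (fps_compX u0).
  by rewrite (fps_compV u0 Uz) zu.
- rewrite -(fps_compA _ w0 u0) etaE (fps_compM u0); exact (f_equal2 *%R Lz LzV).
- rewrite -(fps_compA _ w0 u0) -{2}(fps_compX u0) -zB1 -(fps_compM u0) HE.
  rewrite fps_compB (fps_compM u0).
  exact (f_equal2 (fun a b => a - b) Lz (f_equal2 *%R zu LzV)).
Qed.
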